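(* Let $C$ be a Reedy category, let $\Gamma$ be one of $\int N(C)$, $\int N^{-,+}(C)$, $\int N^{--,+}_+(C)$, and let $(\alpha,\theta),(\alpha',\theta')\colon([m],X)\to([n],Y)$ be parallel morphisms in $\Gamma$. The following are equivalent: (1) $(\alpha,\theta)$ and $(\alpha',\theta')$ are equivalent; (2) $(\alpha,\theta)$ and $(\alpha',\theta')$ have a common upper bound in $\mathrm{Hom}_\Gamma(([m],X),([n],Y))$; (3) the largest element of $\{\psi:(\alpha,\theta)\le\psi\}$ coincides with the largest element of $\{\psi:(\alpha',\theta')\le\psi\}$ (these largest elements exist).
   Context: A Reedy category $(C,C_-,C_+)$: wide subcategories with unique factorization of every morphism as ($C_-$ then $C_+$), membership in $C_\pm$ decidable, and the relation ($x<'y$ iff non-identity $x\to y$ in $C_+$ or non-identity $y\to x$ in $C_-$) well-founded. $\Delta$: finite ordinals $[n]$ and order-preserving maps. $\int N(C)$: objects $([n],X)$ with $X\colon[n]\to C$ a functor; morphisms $([m],X)\to([n],Y)$ are $(\alpha,\theta)$, $\alpha\colon[m]\to[n]$ in $\Delta$, $\theta\colon X\Rightarrow Y\circ\alpha$; composition $(\beta,\varphi)\circ(\alpha,\theta)=(\beta\alpha,(\varphi\alpha)\circ\theta)$. $\int N^{-,+}(C)$: subcategory of objects with $X$ sending all morphisms into $C_-$ and morphisms with all $\theta_i\in C_+$. $\int N^{--,+}_+(C)$: its subcategory of objects whose $X$ reflects identities and morphisms with $\alpha$ injective. Order on hom-sets: $(\alpha,\theta)\le(\alpha',\theta')$ iff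 $\alpha\le\alpha'$ pointwise and $\theta'_i=Y(\alpha(i)\le\alpha'(i))\circ\theta_i$ for all $i$. Two parallel morphisms are equivalent if related by the equivalence relation (symmetric transitive closure) generated by $\le$ on the hom-set. *)

(* Defs.v *)
From Stdlib Require Import Relation_Operators.
From mathcomp Require Import all_boot.

Set Implicit Arguments.
Unset Strict Implicit.
Unset Printing Implicit Defensive.

Record Category := {
  obj :> Type;
  hom : obj -> obj -> Type;
  idm : forall a, hom a a;
  comp : forall a b c, hom b c -> hom a b -> hom a c;  (* comp g f = g o f *)
  comp_idl : forall a b (f : hom a b), comp (idm b) f = f;
  comp_idr : forall a b (f : hom a b), comp f (idm a) = f;
  comp_assoc : forall a b c d (f : hom a b) (g : hom b c) (h : hom c d),
      comp h (comp g f) = comp (comp h g) f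
}.
Arguments hom {C} a b : rename.
Arguments idm {C} a : rename.
Arguments comp {C a b c} g f : rename.

Definition is_idm (C : Category) (a b : C) (f : hom a b) : Prop :=
  exists e : a = b, eq_rect a (fun c => hom a c) (idm a) b e = f.

Definition is_fact (C : Category) (minus plus : forall a b : C, hom a b -> bool)
    (a b : C) (f : hom a b) (s : {c : C & (hom a c * hom c b)%type}) : Prop :=
  minus _ _ (projT2 s).1 /\ plus _ _ (projT2 s).2 /\ comp (projT2 s).2 (projT2 s).1 = f.

Definition reedy_lt (C : Category) (minus plus : forall a b : C, hom a b -> bool)
    (x y : C) : Prop :=
  (exists f : hom x y, plus _ _ f /\ ~ is_idm f) \/
  (exists g : hom y x, minus _ _ g /\ ~ is_idm g).

Record Reedy := {
  rcat :> Category;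
  minus : forall a b : rcat, hom a b -> bool;
  plus : forall a b : rcat, hom a b -> bool;
  minus_id : forall a, minus (idm a);
  plus_id : forall a, plus (idm a);
  minus_comp : forall a b c (f : hom a b) (g : hom b c),
      minus f -> minus g -> minus (comp g f);
  plus_comp : forall a b c (f : hom a b) (g : hom b c),
      plus f -> plus g -> plus (comp g f);
  reedy_fact : forall a b (f : hom a b),
      exists s, is_fact minus plus f s /\ forall s', is_fact minus plus f s' -> s' = s;
  reedy_wf : well_founded (reedy_lt minus plus)
}.
Arguments minus {R a b} f : rename.
Arguments plus {R a b} f : rename.

(** * Functors [n] -> C  ([n] = 'I_n.+1 with its order) *)
Record NFun (C : Category) (n : nat) := {
  fob : 'I_n.+1 -> C;
  fmor : forall i j : 'I_n.+1, i <= j -> hom (fob i) (fob j);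
  fmor_id : forall (i : 'I_n.+1) (h : i <= i), fmor h = idm (fob i);
  fmor_comp : forall i j k : 'I_n.+1, forall (hij : i <= j) (hjk : j <= k) (hik : i <= k),
      fmor hik = comp (fmor hjk) (fmor hij)
}.
Arguments fob {C n} _ _.
Arguments fmor {C n} _ {i j} _.

Record GMor (C : Category) (m n : nat) (X : NFun C m) (Y : NFun C n) := {
  alpha : 'I_m.+1 -> 'I_n.+1;
  alpha_mono : forall i j : 'I_m.+1, i <= j -> alpha i <= alpha j;
  theta : forall i, hom (fob X i) (fob Y (alpha i));
  theta_nat : forall i j : 'I_m.+1, forall (hij : i <= j),
      comp (fmor Y (alpha_mono hij)) (theta i) = comp (theta j) (fmor X hij)
}.
Arguments alpha {C m n X Y} _ _.
Arguments theta {C m n X Y} _ _.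

Definition gle (C : Category) (m n : nat) (X : NFun C m) (Y : NFun C n)
    (f g : GMor X Y) : Prop :=
  exists hle : forall i, alpha f i <= alpha g i,
    forall i, theta g i = comp (fmor Y (hle i)) (theta f i).

Inductive GammaKind := IntN | IntNmp | IntNmmp.

Definition obj_in (R : Reedy) (k : GammaKind) (n : nat) (X : NFun R n) : Prop :=
  match k with
  | IntN => True
  | IntNmp => forall i j : 'I_n.+1, forall (h : i <= j), minus (fmor X h)
  | IntNmmp => (forall i j : 'I_n.+1, forall (h : i <= j), minus (fmor X h)) /\
               (forall i j : 'I_n.+1, forall (h : i <= j), is_idm (fmor X h) -> i = j)
  end.

Definition mor_in (R : Reedy) (k : GammaKind) (m n : nat) (X : NFun R m) (Y : NFun R n)
    (f : GMor X Y) : Prop :=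
  match k with
  | IntN => True
  | IntNmp => forall i, plus (theta f i)
  | IntNmmp => (forall i, plus (theta f i)) /\ injective (alpha f)
  end.

Definition gequiv (R : Reedy) (k : GammaKind) (m n : nat) (X : NFun R m) (Y : NFun R n)
    (f g : GMor X Y) : Prop :=
  clos_refl_sym_trans (GMor X Y)
    (fun a b => mor_in k a /\ mor_in k b /\ gle a b) f g.

Definition is_largest_above (R : Reedy) (k : GammaKind) (m n : nat)
    (X : NFun R m) (Y : NFun R n) (f psi : GMor X Y) : Prop :=
  mor_in k psi /\ gle f psi /\
  forall phi, mor_in k phi -> gle f phi -> gle phi psi.

(* Main.v *)
(* For (alpha, theta) in Gamma, push each theta_i along Y as far as it stays in C_+
   (as far as possible, for the full Grothendieck construction): beta(i) is the largest
   b >= alpha(i) with Y(alpha(i) <= b) o theta_i in C_+.  The Reedy axioms make C_+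
   right-cancellable against C_-: if g o m is in C_+ and m is in C_-, then so is g
   (unique factorization, and the well-founded relation has no 2-cycles).  As the
   structure maps of X lie in C_-, this makes beta monotone, and
   (beta, Y(alpha <= beta) o theta) is the largest morphism above (alpha, theta).
   Comparable morphisms have the same largest element above them, so it is an invariant
   of the equivalence class; conversely, two morphisms with the same largest element
   have it as a common upper bound. *)

From Stdlib Require Import Relation_Operators Operators_Properties.
From Stdlib Require Import Classical ProofIrrelevance FunctionalExtensionality.
From mathcomp Require Import all_boot.
Require Import Defs.

Set Implicit Arguments.
Unset Strict Implicit.
Unset Printing Implicit Defensive.

Lemma well_founded_asym (A : Type) (lt : A -> A -> Prop) (x y : A) :
  well_founded lt -> lt x y -> lt y x -> False.
Proof.
move=> wf; elim: (wf x) y => {}x _ IH y lt_xy lt_yx.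
exact: (IH y lt_yx x lt_yx lt_xy).
Qed.

Lemma is_idm_of_fact_eq (C : Category) (a b c : C) (m : hom a b) (p : hom b c)
    (q : hom a c) :
  existT (fun d => (hom a d * hom d c)%type) b (m, p) =
  existT (fun d => (hom a d * hom d c)%type) a (idm a, q) -> is_idm m.
Proof.
move=> E; have: is_idm (projT2 (existT (fun d => (hom a d * hom d c)%type) a (idm a, q))).1.
  by exists erefl.
by rewrite -E.
Qed.

Section ReedyCancellation.

Variable R : Reedy.

Lemma is_idm_plus (a b : R) (u : hom a b) : is_idm u -> plus u.
Proof. by case=> e; case: b / e u => u <-; exact: plus_id. Qed.

Lemma reedy_fact_unique (a b : R) (f : hom a b) s s' :
  is_fact (@minus R) (@plus R) f s -> is_fact (@minus R) (@plus R) f s' -> s = s'.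
Proof.
have [s0 [_ uniq_s0]] := reedy_fact f.
by move=> /uniq_s0 -> /uniq_s0 ->.
Qed.

(* (m, p) and (idm, q) are both factorizations of q. *)
Lemma plus_fact_idm (a b c : R) (m : hom a b) (p : hom b c) (q : hom a c) :
  minus m -> plus p -> plus q -> comp p m = q -> is_idm m.
Proof.
move=> mm pp pq pm_q; apply: (@is_idm_of_fact_eq _ _ _ _ m p q).
by apply: (@reedy_fact_unique _ _ q); do !split=> //=;
  [exact: minus_id | exact: comp_idr].
Qed.

Lemma minus_retraction_idm (a b c : R) (m : hom a b) (r : hom b c) :
  minus m -> minus r -> is_idm (comp r m) -> is_idm r.
Proof.
move=> mm mr [e rm_id]; case: c / e r mr rm_id => r mr /= rm_id.
have [[e m_id] | m_nid] := classic (is_idm m).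
  case: b / e m r mm mr rm_id m_id => m r _ _ /= rm_id m_id.
  by exists erefl; rewrite /= rm_id -m_id comp_idr.
apply: NNPP => r_nid; apply: (well_founded_asym (@reedy_wf R) (x := a) (y := b)).
- by right; exists r.
- by right; exists m.
Qed.

Lemma plus_cancel_minus (a b c : R) (g : hom b c) (m : hom a b) :
  minus m -> plus (comp g m) -> plus g.
Proof.
move=> mm pgm.
have [[d [m' p]] [[/= mm' [pp pm'_g]] _]] := reedy_fact g.
have /(minus_retraction_idm mm mm') [e m'_id] : is_idm (comp m' m).
  apply: (plus_fact_idm (p := p)) => //; first exact: minus_comp.
  by rewrite comp_assoc pm'_g.
by case: d / e m' p mm' pp pm'_g m'_id => m' p _ pp <- /= <-; rewrite comp_idr.
Qed.

End ReedyCancellation.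

Section HomOrder.

Variables (C : Category) (m n : nat) (X : NFun C m) (Y : NFun C n).

Lemma comp_fmor (i j l : 'I_n.+1) (hij : i <= j) (hjl : j <= l) (hil : i <= l) :
  comp (fmor Y hjl) (fmor Y hij) = fmor Y hil.
Proof. by rewrite (fmor_comp _ hij hjl). Qed.

Lemma fmor_is_idm (i j : 'I_n.+1) (hij : i <= j) : i = j -> is_idm (fmor Y hij).
Proof. by move=> e; case: j / e hij => hij; exists erefl; rewrite fmor_id. Qed.

Lemma gle_trans (f g h : GMor X Y) : gle f g -> gle g h -> gle f h.
Proof.
move=> [le_fg theta_g] [le_gh theta_h].
exists (fun i => leq_trans (le_fg i) (le_gh i)) => i.
by rewrite theta_h theta_g (fmor_comp Y (le_fg i) (le_gh i)) comp_assoc.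
Qed.

Lemma gle_antisym (f g : GMor X Y) : gle f g -> gle g f -> f = g.
Proof.
case: f g => [af af_mono tf tf_nat] [ag ag_mono tg tg_nat] [/= le_fg theta_g] [/= le_gf _].
have E : af = ag.
  by apply: functional_extensionality => i; apply/val_inj/eqP; rewrite eqn_leq le_fg le_gf.
case: ag / E ag_mono tg tg_nat le_fg theta_g le_gf => ag_mono tg tg_nat le_fg theta_g _.
have E : tf = tg.
  by apply: functional_extensionality_dep => i; rewrite theta_g fmor_id comp_idl.
case: tg / E tg_nat theta_g => tg_nat _.
case: _ / (proof_irrelevance _ af_mono ag_mono) in tg_nat *.
by rewrite (proof_irrelevance _ tg_nat tf_nat).
Qed.

End HomOrder.

Section Admissibility.

Variables (R : Reedy) (k : GammaKind).

Definition comp_ok (a b : R) (g : hom a b) : bool :=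
  if k is IntN then true else plus g.

Lemma mor_in_comp_ok m n (X : NFun R m) (Y : NFun R n) (f : GMor X Y) i :
  mor_in k f -> comp_ok (theta f i).
Proof. by rewrite /comp_ok; case: k => //= -[]. Qed.

Lemma mor_inP m n (X : NFun R m) (Y : NFun R n) (f : GMor X Y) :
  (forall i, comp_ok (theta f i)) -> (k = IntNmmp -> injective (alpha f)) -> mor_in k f.
Proof. by rewrite /comp_ok; case: k => //= ok inj; split=> //; exact: inj. Qed.

Lemma comp_ok_cancel n (X : NFun R n) (i j : 'I_n.+1) (hij : i <= j) (c : R)
    (g : hom (fob X j) c) :
  obj_in k X -> comp_ok (comp g (fmor X hij)) -> comp_ok g.
Proof.
rewrite /comp_ok; case: k => //= [minusX | [minusX _]];
  exact/plus_cancel_minus/minusX.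
Qed.

Definition ext_ok n (Y : NFun R n) (x : R) (a : 'I_n.+1) (t : hom x (fob Y a))
    (b : 'I_n.+1) : bool :=
  if Bool.bool_dec (a <= b) true is left h then comp_ok (comp (fmor Y h) t) else false.

Lemma ext_okP n (Y : NFun R n) (x : R) (a : 'I_n.+1) (t : hom x (fob Y a))
    (b : 'I_n.+1) :
  reflect (exists h : a <= b, comp_ok (comp (fmor Y h) t)) (ext_ok t b).
Proof.
rewrite /ext_ok; case: Bool.bool_dec => [h | nh]; last by constructor; case.
by apply: (iffP idP) => [ok | [h' ok]]; [exists h | rewrite (bool_irrelevance h h')].
Qed.

End Admissibility.

Section LargestAbove.

Variables (R : Reedy) (k : GammaKind) (m n : nat) (X : NFun R m) (Y : NFun R n).
Variable f : GMor X Y.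
Hypotheses (objX : obj_in k X) (morf : mor_in k f).

Definition top_index (i : 'I_m.+1) : 'I_n.+1 :=
  [arg max_(b > alpha f i | ext_ok k (theta f i) b) (b : nat)].

Lemma top_indexP i :
  ext_ok k (theta f i) (top_index i) /\
  forall b, ext_ok k (theta f i) b -> b <= top_index i.
Proof.
have ok_alpha : ext_ok k (theta f i) (alpha f i).
  by apply/ext_okP; exists (leqnn _); rewrite fmor_id comp_idl mor_in_comp_ok.
by rewrite /top_index; case: arg_maxnP.
Qed.

Lemma alpha_le_top i : alpha f i <= top_index i.
Proof. by have [/ext_okP [h _] _] := top_indexP i. Qed.

Definition top_theta i : hom (fob X i) (fob Y (top_index i)) :=
  comp (fmor Y (alpha_le_top i)) (theta f i).

Lemma top_theta_ok i : comp_ok k (top_theta i).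
Proof.
have [/ext_okP [h ok] _] := top_indexP i.
by rewrite /top_theta (bool_irrelevance (alpha_le_top i) h).
Qed.

Lemma top_index_mono (i j : 'I_m.+1) : i <= j -> top_index i <= top_index j.
Proof.
move=> hij; case: (leqP (top_index i) (alpha f j)) => [le_ij | lt_ji].
  exact: leq_trans le_ij (alpha_le_top j).
apply: (proj2 (top_indexP j)); apply/ext_okP; exists (ltnW lt_ji).
apply: (comp_ok_cancel (hij := hij) objX).
rewrite -comp_assoc -theta_nat comp_assoc -(fmor_comp Y _ _ (alpha_le_top i)).
exact: top_theta_ok.
Qed.

Lemma top_theta_nat (i j : 'I_m.+1) (hij : i <= j) :
  comp (fmor Y (top_index_mono hij)) (top_theta i) = comp (top_theta j) (fmor X hij).
Proof.
have le_ij := leq_trans (alpha_le_top i) (top_index_mono hij).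
by rewrite /top_theta -comp_assoc -theta_nat !comp_assoc !(comp_fmor Y _ _ le_ij).
Qed.

Definition top_mor : GMor X Y := Build_GMor top_theta_nat.

Lemma le_top_mor : gle f top_mor.
Proof. by exists alpha_le_top. Qed.

Lemma top_mor_max (phi : GMor X Y) : mor_in k phi -> gle f phi -> gle phi top_mor.
Proof.
move=> morphi [le_f theta_phi].
have le_top i : alpha phi i <= top_index i.
  apply: (proj2 (top_indexP i)); apply/ext_okP; exists (le_f i).
  by rewrite -theta_phi mor_in_comp_ok.
exists le_top => i /=.
by rewrite /top_theta theta_phi comp_assoc (comp_fmor Y _ _ (alpha_le_top i)).
Qed.

Lemma top_index_inj : k = IntNmmp -> injective top_index.
Proof.
move=> kE; have [minusX reflX] : obj_in IntNmmp X by rewrite -kE.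
have ok i : plus (top_theta i) by have := top_theta_ok i; rewrite kE.
suff inj_le (i j : 'I_m.+1) : i <= j -> top_index i = top_index j -> i = j.
  by move=> i j E; case/orP: (leq_total i j) => [/inj_le | /inj_le/(_ (esym E))/esym]; apply.
move=> hij E; apply: (reflX _ _ hij).
(* If beta i = beta j, naturality factors top_theta i (in C_+) through X(i <= j) in C_-. *)
apply: (plus_fact_idm (p := top_theta j)
                      (q := comp (fmor Y (top_index_mono hij)) (top_theta i))).
- exact: minusX.
- exact: ok.
- exact: plus_comp (ok i) (is_idm_plus (fmor_is_idm Y _ E)).
- by rewrite top_theta_nat.
Qed.

Lemma largest_above_top_mor : is_largest_above k f top_mor.
Proof.
split; last by split; [exact: le_top_mor | exact: top_mor_max].
by apply: mor_inP => [i | /top_index_inj]; [exact: top_theta_ok |].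
Qed.

End LargestAbove.

Section LargestAboveInvariant.

Variables (R : Reedy) (k : GammaKind) (m n : nat) (X : NFun R m) (Y : NFun R n).

Lemma largest_above_exists (f : GMor X Y) :
  obj_in k X -> mor_in k f -> exists psi, is_largest_above k f psi.
Proof. by move=> objX morf; exists (top_mor objX morf); exact: largest_above_top_mor. Qed.

Lemma largest_above_le (f g psi psi' : GMor X Y) :
  mor_in k g -> gle f g -> is_largest_above k f psi -> is_largest_above k g psi' ->
  psi = psi'.
Proof.
move=> morg le_fg [morpsi [_ max_f]] [morpsi' [le_g max_g]].
apply: gle_antisym; first by apply: max_g => //; exact: max_f.
by apply: max_f => //; exact: gle_trans le_g.
Qed.

Lemma largest_above_unique (f psi psi' : GMor X Y) :
  is_largest_above k f psi -> is_largest_above k f psi' -> psi = psi'.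
Proof.
move=> [morpsi [le_psi max_psi]] [morpsi' [le_psi' max_psi']].
by apply: gle_antisym; [exact: max_psi' | exact: max_psi].
Qed.

Lemma gequiv_largest_above (f g : GMor X Y) :
  obj_in k X -> mor_in k f -> gequiv k f g ->
  mor_in k g /\
  forall psi psi', is_largest_above k f psi -> is_largest_above k g psi' -> psi = psi'.
Proof.
move=> objX morf /clos_rst_rstn1_iff.
elim=> [|h h' step _ [morh same]]; first by split=> //; exact: largest_above_unique.
have morh' : mor_in k h' by case: step => [[_ [morh' _]] | [morh' _]].
split=> // psi psi' Hpsi Hpsi'.
have [psih Hpsih] := largest_above_exists objX morh.
rewrite (same _ _ Hpsi Hpsih).
case: step => [[_ [_ le]] | [_ [_ le]]]; first exact: largest_above_le Hpsih Hpsi'.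
by apply/esym; exact: largest_above_le Hpsi' Hpsih.
Qed.

Lemma common_upper_bound_gequiv (f g psi : GMor X Y) :
  mor_in k f -> mor_in k g -> mor_in k psi -> gle f psi -> gle g psi -> gequiv k f g.
Proof.
move=> morf morg morpsi le_f le_g.
by apply: (rst_trans _ _ _ psi); [|apply: rst_sym]; apply: rst_step.
Qed.

End LargestAboveInvariant.

Theorem proposition4p6 (R : Reedy) (k : GammaKind) (m n : nat)
    (X : NFun R m) (Y : NFun R n) (f f' : GMor X Y) :
  obj_in k X -> obj_in k Y -> mor_in k f -> mor_in k f' ->
  (exists psi, is_largest_above k f psi) /\
  (exists psi', is_largest_above k f' psi') /\
  (gequiv k f f' <-> exists psi, mor_in k psi /\ gle f psi /\ gle f' psi) /\
  (gequiv k f f' <->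
     forall psi psi', is_largest_above k f psi -> is_largest_above k f' psi' -> psi = psi').
Proof.
move=> objX _ morf morf'.
have [psi Hpsi] := largest_above_exists objX morf.
have [psi' Hpsi'] := largest_above_exists objX morf'.
have [[morpsi [le_f _]] [_ [le_f' _]]] := (Hpsi, Hpsi').
have equiv_same : gequiv k f f' <-> psi = psi'.
  split=> [/(gequiv_largest_above objX morf) [_ same] | E]; first exact: same.
  by rewrite -E in le_f'; exact: common_upper_bound_gequiv le_f le_f'.
split; first by exists psi.
split; first by exists psi'.
split; split.
- by move/equiv_same=> E; exists psi; do !split=> //; rewrite E.
- by move=> [phi [morphi [le_phi le_phi']]]; exact: common_upper_bound_gequiv le_phi le_phi'.
- by move/(gequiv_largest_above objX morf) => [].
- by move=> same; apply/equiv_same; exact: same.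
Qed.
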